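(* Let $N,n$ be positive integers and let $\lambda_1,\dots,\lambda_n\in\overline{\mathbb{Q}}^\times$ be pairwise distinct. Put $$\Phi(T):=T\Big(\prod_{i=1}^n (T-\lambda_i)\Big)-1 .$$ Let $X_{N,n}$ be the smooth projective curve over $k_X:=\mathbb{Q}(\lambda_1,\dots,\lambda_n)$ with affine model $x^N+(-1)^n y_i^N=\lambda_i$ ($1\le i\le n$) in $\mathbb{A}^{n+1}$ with coordinates $(x,y_1,\dots,y_n)$, and let $E_{N,n}$ be the smooth projective curve over $k_E$ with affine model $Y^N=X(X-\lambda_1)\cdots(X-\lambda_n)$, where $k_E$ is the field generated over $\mathbb{Q}$ by the coefficients of $\Phi$. Assume that all roots of $\Phi$ are roots of unity. Then $$\{1-xy_1\cdots y_n,\ x\}\in H^2_{\mathscr{M}}(X_{N,n},\mathbb{Q}(2))\subset K_2^M(k_X(X_{N,n}))\otimes\mathbb{Q},\qquad \{1-Y,\ X\}\in H^2_{\mathscr{M}}(E_{N,n},\mathbb{Q}(2))\subset K_2^M(k_E(E_{N,n}))\otimes\mathbb{Q}.$$ If, further, $\Phi(T)\in\mathbb{Z}[T]$, then both elements are integral, that is, $$\{1-xy_1\cdots y_n,\ x\}\in H^2_{\mathscr{M}}(X_{N,n},\mathbb{Q}(2))_{\mathbb{Z}},\qquad \{1-Y,\ X\}\in H^2_{\mathscr{M}}(E_{N,n},\mathbb{Q}(2))_{\mathbb{Z}}.$$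
   Context: The projective curve $X_{N,n}\subset\mathbb{P}^{n+1}$, with homogeneous coordinates $[X:Y_1:\cdots:Y_n:W]$, is given by $X^N+(-1)^nY_i^N=\lambda_iW^N$ for $1\le i\le n$, and $x=X/W$, $y_i=Y_i/W$. (The $X$ in the equation of $E_{N,n}$ is a different coordinate.) For a smooth projective geometrically irreducible curve $C$ over a number field $k$ with function field $k(C)$, $K_2^M(k(C))$ is the Milnor $K_2$-group, with symbols $\{f,g\}$ for $f,g\in k(C)^\times$. The motivic cohomology $H^2_{\mathscr{M}}(C,\mathbb{Q}(2))$ is identified with the kernel of $$\tau\otimes\mathbb{Q}\colon K_2^M(k(C))\otimes\mathbb{Q}\to\bigoplus_{x\in C^{(1)}}\kappa(x)^*\otimes\mathbb{Q},$$ where $C^{(1)}$ is the set of closed points of $C$, $\kappa(x)$ is the residue field, and $\tau=(\tau_x)$ is the tame symbol $$\tau_x(\{f,g\})=(-1)^{\operatorname{ord}_x f\,\operatorname{ord}_x g}\left(\frac{f^{\operatorname{ord}_x g}}{g^{\operatorname{ord}_x f}}\right)(x).$$ The integral part $H^2_{\mathscr{M}}(C,\mathbb{Q}(2))_{\mathbb{Z}}\subset H^2_{\mathscr{M}}(C,\mathbb{Q}(2))$ is defined using a regular proper model $\mathcal{C}$ of $C$ over the ring of integers $\mathscr{O}_k$: it consists of the elements that are also killed by $T_{\mathcal{D}}\otimes\mathbb{Q}$ for every irreducible component $\mathcal{D}$ of every closed fibre of $\mathcal{C}\to\operatorname{Spec}\mathscr{O}_k$, where $$T_{\mathcal{D}}(\{f,g\})=(-1)^{\operatorname{ord}_{\mathcal{D}}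 f\,\operatorname{ord}_{\mathcal{D}} g}\,\frac{f^{\operatorname{ord}_{\mathcal{D}} g}}{g^{\operatorname{ord}_{\mathcal{D}} f}}\Big|_{\mathcal{D}}$$ takes values in the multiplicative group of the function field of $\mathcal{D}$. This subspace is independent of the choice of the model $\mathcal{C}$. *)

(* Defs.v *)
From HB Require Import structures.
From mathcomp Require Import all_boot all_order all_algebra all_field.
From mathcomp Require Import boolp classical_sets zify ring.
From mathcomp.multinomials Require Import freeg mpoly.

Set Implicit Arguments.
Unset Strict Implicit.
Unset Printing Implicit Defensive.

Import Order.TTheory GRing.Theory Num.Theory.
Local Open Scope classical_set_scope.
Local Open Scope quotient_scope.
Local Open Scope ring_scope.

(* The abelian group with generators [T] and relations [rels], written
   additively.  [presented_lift f] evaluates [f] on a representative chosen by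
   [repr]; it is the homomorphism induced by [f] as soon as [f] kills [rels]
   (presented_lift_gen, presented_liftB). *)

Definition subgroup (V : zmodType) (G : set V) : Prop :=
  G 0 /\ forall a b, G a -> G b -> G (a - b).

Section Presented.
Context (T : choiceType) (rels : set {freeg T}).

Definition relator : {pred {freeg T}} :=
  fun z => `[< smallest (@subgroup {freeg T}) rels z >].

Lemma relatorP z : reflect (smallest (@subgroup {freeg T}) rels z) (z \in relator).
Proof. exact: asboolP. Qed.

Lemma relator_zmod_closed : zmod_closed relator.
Proof.
split=> [|a b /relatorP ha /relatorP hb]; apply/relatorP => G HG; have [[G0 GB] sG] := HG.
  exact: G0.
exact: GB (ha G HG) (hb G HG).
Qed.

HB.instance Definition _ :=
  GRing.isZmodClosed.Build {freeg T} relator relator_zmod_closed.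

Definition presented : Type := Quotient.quot relator.
HB.instance Definition _ := GRing.Zmodule.on presented.

Definition presented_gen (t : T) : presented := \pi_(Quotient.quot relator) << t >>.

Section Lift.
Context (B : zmodType) (f : T -> B).

Definition freeg_lift (z : {freeg T}) : B :=
  \sum_(t <- dom z) f t *~ coeff t z.

Definition presented_lift (q : presented) : B :=
  freeg_lift (repr (q : Quotient.quot relator)).

Lemma freeg_lift_widen (s : seq T) z :
  uniq s -> {subset dom z <= s} ->
  freeg_lift z = \sum_(t <- s) f t *~ coeff t z.
Proof.
move=> us sub; rewrite (bigID [pred t | t \in dom z]) /=.
rewrite [X in _ + X]big1 ?addr0; last by move=> t /coeff_outdom ->; rewrite mulr0z.
rewrite -big_filter; apply: perm_big; apply: uniq_perm.
- exact: uniq_dom.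
- exact: filter_uniq.
by move=> t; rewrite mem_filter /=; case: (boolP (t \in dom z)) => //= /sub ->.
Qed.

Lemma freeg_liftB z z' : freeg_lift (z - z') = freeg_lift z - freeg_lift z'.
Proof.
set s := undup (dom z ++ dom z' ++ dom (z - z')).
have us : uniq s by exact: undup_uniq.
rewrite !(@freeg_lift_widen s) // -?sumrB.
- by apply: eq_bigr => t _; rewrite coeffB mulrzBr.
all: by move=> t ht; rewrite mem_undup !mem_cat ht ?orbT.
Qed.

Lemma freeg_liftU t : freeg_lift << t >> = f t.
Proof. by rewrite /freeg_lift domU1 big_seq1 coeffU eqxx mulr1 mulr1z. Qed.

Hypothesis f_rels : forall z, rels z -> freeg_lift z = 0.

Lemma freeg_lift_relator z : z \in relator -> freeg_lift z = 0.
Proof.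
move=> /relatorP hz; apply: (hz [set z | freeg_lift z = 0]).
split=> [|z' /f_rels //]; split=> [|a b ha hb] /=.
  by rewrite -(subrr 0) freeg_liftB subrr.
by rewrite freeg_liftB ha hb subrr.
Qed.

Lemma presented_lift_pi (z : {freeg T}) :
  presented_lift (\pi_(Quotient.quot relator) z) = freeg_lift z.
Proof.
apply/eqP; rewrite -subr_eq0 -freeg_liftB; apply/eqP/freeg_lift_relator.
by rewrite Quotient.idealrBE reprK.
Qed.

Lemma presented_lift_gen t : presented_lift (presented_gen t) = f t.
Proof. by rewrite presented_lift_pi freeg_liftU. Qed.

Lemma presented_liftB : {morph presented_lift : p q / p - q}.
Proof.
move=> p q; rewrite -[p](@reprK _ (Quotient.quot relator)).
rewrite -[q](@reprK _ (Quotient.quot relator)) -(raddfB (\pi_(Quotient.quot relator))).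
by rewrite !presented_lift_pi freeg_liftB.
Qed.

End Lift.
End Presented.

Section Tensor.

Definition tensor_rels (A B : zmodType) : set {freeg (A * B)%type} :=
  [set z | (exists a a' b, z = << (a + a', b) >> - << (a, b) >> - << (a', b) >>)
        \/ (exists a b b', z = << (a, b + b') >> - << (a, b) >> - << (a, b') >>)].

Definition tensor (A B : zmodType) := presented (@tensor_rels A B).
HB.instance Definition _ (A B : zmodType) := GRing.Zmodule.on (tensor A B).

Definition tens (A B : zmodType) (a : A) (b : B) : tensor A B :=
  presented_gen (@tensor_rels A B) (a, b).

Definition tensor_mapl (A A' B : zmodType) (phi : A -> A') : tensor A B -> tensor A' B :=
  presented_lift (fun ab => tens (phi ab.1) ab.2).

End Tensor.

Section TensorHom.
Context (A A' B : zmodType) (phi : A -> A').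
Hypothesis phiB : {morph phi : a b / a - b}.

Let phiD : {morph phi : a b / a + b}.
Proof.
move=> a b; have p0 : phi 0 = 0 by rewrite -(subrr 0) phiB subrr.
by rewrite -{1}[b]opprK phiB -[- b]add0r phiB p0 add0r opprK.
Qed.

Lemma tens_relator (z : {freeg (A' * B)%type}) : tensor_rels z ->
  (\pi_(Quotient.quot (relator (@tensor_rels A' B))) z) = 0.
Proof.
move=> hz; rewrite -(raddf0 (\pi_(Quotient.quot (relator (@tensor_rels A' B))))).
apply/eqP; rewrite -Quotient.idealrBE subr0; apply/relatorP.
by move=> G [_ ]; apply.
Qed.

Lemma tensor_kills z : tensor_rels z ->
  freeg_lift (fun ab : A * B => tens (phi ab.1) ab.2) z = 0.
Proof.
move=> [[a [a' [b ->]]]|[a [b [b' ->]]]]; rewrite !freeg_liftB !freeg_liftU /=.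
  rewrite phiD /tens /presented_gen -!raddfB.
  by apply: tens_relator; left; do 3 eexists.
rewrite /tens /presented_gen -!raddfB.
by apply: tens_relator; right; do 3 eexists.
Qed.

Lemma tensor_maplB : {morph tensor_mapl (B := B) phi : p q / p - q}.
Proof. exact: presented_liftB tensor_kills. Qed.

Lemma tensor_mapl_tens a (b : B) : tensor_mapl phi (tens a b) = tens (phi a) b.
Proof. exact: presented_lift_gen tensor_kills _. Qed.
End TensorHom.

Section MulGroup.
Context (F : fieldType).

(* The multiplicative group of [F] as a zmodType, i.e. written additively. *)
Definition mulgroup := {x : F | x != 0}.
HB.instance Definition _ := SubChoice.on mulgroup.

Definition mg_one : mulgroup := Sub 1 (oner_neq0 F).
Definition to_mg (x : F) : mulgroup := insubd mg_one x.
Definition mg_mul (a b : mulgroup) := to_mg (val a * val b).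
Definition mg_inv (a : mulgroup) := to_mg (val a)^-1.

Lemma val_to_mg x : x != 0 -> val (to_mg x) = x.
Proof. by move=> hx; rewrite insubdK. Qed.

Lemma mg_neq0 (a : mulgroup) : val a != 0. Proof. by case: a. Qed.

Lemma val_mg_mul a b : val (mg_mul a b) = val a * val b.
Proof. by rewrite val_to_mg // mulf_neq0 ?mg_neq0. Qed.

Lemma val_mg_inv a : val (mg_inv a) = (val a)^-1.
Proof. by rewrite val_to_mg // invr_neq0 ?mg_neq0. Qed.

Lemma mg_mulA : associative mg_mul.
Proof. by move=> a b c; apply: val_inj; rewrite !val_mg_mul mulrA. Qed.
Lemma mg_mulC : commutative mg_mul.
Proof. by move=> a b; apply: val_inj; rewrite !val_mg_mul mulrC. Qed.
Lemma mg_mul1 : left_id mg_one mg_mul.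
Proof. by move=> a; apply: val_inj; rewrite val_mg_mul mul1r. Qed.
Lemma mg_mulV : left_inverse mg_one mg_inv mg_mul.
Proof.
by move=> a; apply: val_inj; rewrite val_mg_mul val_mg_inv mulVf ?mg_neq0.
Qed.

HB.instance Definition _ :=
  GRing.isZmodule.Build mulgroup mg_mulA mg_mulC mg_mul1 mg_mulV.

Lemma val_mgD (a b : mulgroup) : val (a + b) = val a * val b.
Proof. exact: val_mg_mul. Qed.

End MulGroup.

Section MilnorK2.
Context (F : fieldType).
Local Notation U := (mulgroup F).

Definition K2_rels : set {freeg (U * U)%type} :=
  [set z | tensor_rels z \/
           exists a b : U, val a + val b = 1 /\ z = << (a, b) >>].

Definition K2M := presented K2_rels.
HB.instance Definition _ := GRing.Zmodule.on K2M.

Definition symbol (f g : U) : K2M := presented_gen K2_rels (f, g).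

Definition K2MQ := tensor K2M rat.

(* "{f, g} lies in H" for nonzero [f], [g]. *)
Definition symbol_in (H : set K2MQ) (f g : F) : Prop :=
  exists a b : U, [/\ val a = f, val b = g & H (tens (symbol a b) (1 : rat))].

End MilnorK2.

Section LocalRings.
Context (K : fieldType).
Implicit Types (A B R V p I : set K) (M : set (set K)).

Definition subring A : Prop :=
  [/\ A 1, forall a b, A a -> A b -> A (a - b)
    & forall a b, A a -> A b -> A (a * b)].

Definition adjoin A (S : set K) : set K := smallest subring (A `|` S).

Definition prime_ideal A p : Prop :=
  [/\ p `<=` A, p 0 /\ (forall a b, p a -> p b -> p (a + b)),
      forall a b, A a -> p b -> p (a * b), ~ p 1
    & forall a b, A a -> A b -> p (a * b) -> p a \/ p b].

Definition localize A p : set K :=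
  [set z | exists a b, [/\ A a, A b, ~ p b & z = a / b]].

(* The local rings O_x, for x in Spec A, inside the field K.  An integral
   separated scheme with function field K is encoded by the set of its local
   rings (Chevalley, Zariski); x' is a specialization of x iff O_x' `<=` O_x. *)
Definition spec A : set (set K) :=
  [set R | exists p, prime_ideal A p /\ R = localize A p].

Definition birational A : Prop := localize A [set 0] = [set: K].

(* The non-units of [R]; 0 is separate because 0^-1 = 0. *)
Definition maxideal R : set K := [set z | R z /\ (z = 0 \/ ~ R z^-1)].

Definition valuation_ring V : Prop := subring V /\ forall z, V z \/ V z^-1.

Definition dominates V R : Prop := R `<=` V /\ maxideal R `<=` maxideal V.

(* Integral schemes, of finite type and proper over Spec A, with function field
   K (valuative criterion of properness). *)
Definition proper_model A M : Prop :=
  (exists charts : seq (seq K),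
     (forall s, s \in charts -> birational (adjoin A [set` s])) /\
     M = \bigcup_(s in [set` charts]) spec (adjoin A [set` s])) /\
  (forall V, valuation_ring V -> A `<=` V -> exists! R, M R /\ dominates V R).

Definition prime_chain R (d : nat) : Prop :=
  exists P : nat -> set K,
    (forall i, (i <= d)%N -> prime_ideal R (P i)) /\
    (forall i, (i < d)%N -> P i `<` P i.+1).

Definition krull_dim R (d : nat) : Prop := prime_chain R d /\ ~ prime_chain R d.+1.

Definition ideal_gen R (d : nat) (t : 'I_d -> K) : set K :=
  [set z | exists c : 'I_d -> K, (forall i, R (c i)) /\ z = \sum_i c i * t i].

(* All rings in use are localizations of rings of finite type over a field or a
   Dedekind domain, hence Noetherian. *)
Definition regular_local R : Prop :=
  exists d (t : 'I_d -> K),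
    [/\ krull_dim R d, forall i, maxideal R (t i) & maxideal R = ideal_gen R t].

Definition closed_point M R : Prop :=
  M R /\ forall R', M R' -> R' `<=` R -> R' = R.

Definition fibre A M p : set (set K) := [set R | M R /\ maxideal R `&` A = p].

(* The generic points of the irreducible components of the closed fibres of
   a model over a one-dimensional domain A. *)
Definition closed_fibre_component A M R : Prop :=
  exists p, [/\ prime_ideal A p, p <> [set 0], fibre A M p R
              & forall R', fibre A M p R' -> R `<=` R' -> R' = R].

(* [v] is the normalized discrete valuation with valuation ring [R]; [v 0] is
   irrelevant. *)
Definition is_ord R (v : K -> int) : Prop :=
  [/\ forall f g : K, f != 0 -> g != 0 -> v (f * g) = v f + v g,
      forall f g : K, f != 0 -> g != 0 -> f + g != 0 ->
        Num.min (v f) (v g) <= v (f + g),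
      exists2 f : K, f != 0 & v f = 1
    & R = [set f | f = 0 \/ 0 <= v f]].

(* [res] exhibits [kappa] as the residue field of [R]; its values outside [R]
   are irrelevant. *)
Definition is_residue R (kappa : fieldType) (res : K -> kappa) : Prop :=
  [/\ res 1 = 1 /\ (forall f g, R f -> R g -> res (f + g) = res f + res g),
      forall f g, R f -> R g -> res (f * g) = res f * res g,
      forall f, R f -> (res f = 0 <-> maxideal R f)
    & forall c, exists2 f, R f & res f = c].

Section Tame.
Context (v : K -> int) (kappa : fieldType) (res : K -> kappa).

Definition tame_formula (f g : K) : kappa :=
  res ((-1) ^ (v f * v g) * (f ^ v g / g ^ v f)).

Definition tame : K2M K -> mulgroup kappa :=
  presented_lift (fun fg => to_mg (tame_formula (val fg.1) (val fg.2))).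

Definition tameQ : K2MQ K -> tensor (mulgroup kappa) rat := tensor_mapl tame.

End Tame.

(* [xi] is killed by the tame symbol, tensored with Q, of the discrete valuation
   ring [R].  All choices of [v] and of ([kappa], [res]) are canonically
   isomorphic, and they exist when R is a discrete valuation ring, as at a closed
   point of a smooth curve or at a point of codimension 1 of a regular model.
   See tameB, tame_symbol, tensor_maplB, tensor_mapl_tens. *)
Definition killed_at R (xi : K2MQ K) : Prop :=
  forall (v : K -> int) (kappa : fieldType) (res : K -> kappa),
    is_ord R v -> is_residue R res -> tameQ v res xi = 0.

End LocalRings.

Section TameHom.
Context (K : fieldType) (R : set K) (v : K -> int).
Context (kappa : fieldType) (res : K -> kappa).
Hypotheses (v_ord : is_ord R v) (res_residue : is_residue R res).

Let vM (f g : K) : f != 0 -> g != 0 -> v (f * g) = v f + v g.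
Proof. by case: v_ord => vM _ _ _; apply: vM. Qed.

Let RE (f : K) : f != 0 -> R f <-> 0 <= v f.
Proof.
case: v_ord => _ _ _ -> /= f0; split=> [[/eqP|//]|]; last by right.
by rewrite (negPf f0).
Qed.

Let v1 : v 1 = 0.
Proof. by have /(congr1 (fun x => x - v 1)) := vM (oner_neq0 K) (oner_neq0 K); rewrite mulr1 subrr addrK. Qed.

Let vV (f : K) : f != 0 -> v f^-1 = - v f.
Proof.
move=> f0; apply/eqP; rewrite -addr_eq0 addrC -vM ?invr_eq0 //.
by rewrite divff // v1.
Qed.

Let vX f (n : nat) : f != 0 -> v (f ^+ n) = v f * n%:Z.
Proof.
move=> f0; elim: n => [|n IH]; first by rewrite expr0 v1 mulr0.
by rewrite exprS vM ?expf_neq0 // IH -{1}[v f]mulr1 -mulrDr.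
Qed.

Let vz f (n : int) : f != 0 -> v (f ^ n) = v f * n.
Proof.
move=> f0; case: n => n; first exact: vX.
by rewrite NegzE -exprnN vV ?expf_neq0 // vX // mulrN.
Qed.

Let N1 : (-1 : K) != 0. Proof. by rewrite oppr_eq0 oner_eq0. Qed.

Let vN1 : v (-1) = 0.
Proof.
have := vM N1 N1; rewrite mulrNN mulr1 v1; lia.
Qed.

Let T (f g : K) := (-1) ^ (v f * v g) * (f ^ v g / g ^ v f).

Let T0 (f g : K) : f != 0 -> g != 0 -> T f g != 0.
Proof.
by move=> f0 g0; rewrite /T !mulf_neq0 ?invr_eq0 ?expfz_neq0.
Qed.

Let vT (f g : K) : f != 0 -> g != 0 -> v (T f g) = 0.
Proof.
move=> f0 g0; have nz := expfz_neq0.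
by rewrite /T !vM ?mulf_neq0 ?invr_eq0 ?nz // vV ?nz // !vz // vN1 mul0r add0r mulrC subrr.
Qed.

Let RT (f g : K) : f != 0 -> g != 0 -> R (T f g).
Proof. by move=> f0 g0; apply/RE; rewrite ?T0 ?vT. Qed.

Let resM (f g : K) : R f -> R g -> res (f * g) = res f * res g.
Proof. by case: res_residue => _ h _ _; apply: h. Qed.

Let res_eq0 (f : K) : f != 0 -> R f -> res f = 0 <-> 0 < v f.
Proof.
move=> f0 Rf; case: res_residue => _ _ h _; apply: iff_trans (h _ Rf) _.
have f'0 : f^-1 != 0 by rewrite invr_eq0.
have := RE f'0; rewrite vV // => Ef; split.
  move=> [_ [/eqP|nR]]; first by rewrite (negPf f0).
  by rewrite ltNge; apply/negP => h0; apply: nR; apply/Ef; lia.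
by move=> vf; split=> //; right=> /Ef; lia.
Qed.

Let res1 : res 1 = 1. Proof. by case: res_residue => -[]. Qed.
Let resD (f g : K) : R f -> R g -> res (f + g) = res f + res g.
Proof. by case: res_residue => -[_ h] _ _ _; apply: h. Qed.

Let T_neq0 (f g : K) : f != 0 -> g != 0 -> tame_formula v res f g != 0.
Proof.
move=> f0 g0; apply/eqP => /(res_eq0 (T0 f0 g0) (RT f0 g0)).
by rewrite vT.
Qed.

Let TDl (f f' g : K) : f != 0 -> f' != 0 -> g != 0 -> T (f * f') g = T f g * T f' g.
Proof.
move=> f0 f'0 g0; rewrite /T vM // mulrDl !expfzDr // expfzMl invfM.
ring.
Qed.

Let TDr (f g g' : K) : f != 0 -> g != 0 -> g' != 0 -> T f (g * g') = T f g * T f g'.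
Proof.
move=> f0 f'0 g0; rewrite /T vM // mulrDr !expfzDr // expfzMl invfM.
ring.
Qed.

Let R0 : R 0. Proof. by case: v_ord => _ _ _ ->; left. Qed.
Let R1 : R 1. Proof. by apply/RE; rewrite ?oner_eq0 ?v1. Qed.
Let vD (f g : K) : f != 0 -> g != 0 -> f + g != 0 -> Num.min (v f) (v g) <= v (f + g).
Proof. by case: v_ord => _ h _ _; apply: h. Qed.
Let res_pos (f : K) : f != 0 -> 0 < v f -> res f = 0.
Proof. by move=> f0 vf; apply/res_eq0 => //; apply/RE; lia. Qed.
Let resX (f : K) (n : nat) : R f -> R (f ^+ n) /\ res (f ^+ n) = res f ^+ n.
Proof.
move=> Rf; elim: n => [|n [Rn IH]]; first by rewrite !expr0.
rewrite !exprS resM // IH; split=> //; case: (eqVneq f 0) => [->|f0]; first by rewrite mul0r.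
apply/RE; first by rewrite mulf_neq0 ?expf_neq0.
have fn0 : f ^+ n != 0 by rewrite expf_neq0.
by have /(RE f0) h1 := Rf; have /(RE fn0) h2 := Rn; rewrite vM //; lia.
Qed.



Let vN (f : K) : f != 0 -> v (- f) = v f.
Proof. by move=> f0; rewrite -mulN1r vM // vN1 add0r. Qed.

(* ultrametric for f + g = 1 *)
Let tri (f g : K) : f != 0 -> g != 0 -> f + g = 1 -> Num.min (v f) (v g) <= 0.
Proof. by move=> f0 g0 e; have := vD f0 g0; rewrite e oner_eq0 v1; apply. Qed.
Let tri' (f g : K) : f != 0 -> g != 0 -> f + g = 1 -> Num.min 0 (v f) <= v g.
Proof.
move=> f0 g0 e; have -> : g = 1 + - f by rewrite -e addrAC subrr add0r.
rewrite -v1 -(vN f0); apply: vD; rewrite ?oner_eq0 ?oppr_eq0 //.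
by rewrite -e addrAC subrr add0r.
Qed.

Let steinberg_pos (f g : K) : f != 0 -> g != 0 -> f + g = 1 -> 0 < v f -> v g = 0 /\ res g = 1.
Proof.
move=> f0 g0 e vf; have := tri f0 g0 e; have := tri' f0 g0 e => h1 h2.
have vg : v g = 0 by move: h1 h2; lia.
split=> //; have Rf : R f by apply/RE => //; lia.
have Rg : R g by apply/RE => //; rewrite vg.
by have := resD Rf Rg; rewrite e res1 (res_pos f0 vf) add0r.
Qed.

Let steinberg (f g : K) : f != 0 -> g != 0 -> f + g = 1 -> tame_formula v res f g = 1.
Proof.
move=> f0 g0 e; have e' : g + f = 1 by rewrite addrC.
rewrite /tame_formula; case: (ltgtP (v f) 0) => vf.
- have vg : v g = v f.
    have := tri' f0 g0 e; have := tri' g0 f0 e'; move: vf; lia.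
  set n := `|v f|%N; have nE : v f = - n%:Z by rewrite /n; lia.
  have fg0 : f^-1 != 0 by rewrite invr_eq0.
  have vfg : v (g / f) = 0 by rewrite vM // vV // vg subrr.
  have nz : g / f != 0 by rewrite mulf_neq0.
  have Rgf : R (g / f) by apply/RE => //; rewrite vfg.
  have rgf : res (g / f) = -1.
    apply/eqP; rewrite -addr_eq0 -res1 -resD //; apply/eqP.
    have -> : g / f + 1 = f^-1 by rewrite -[X in _ + X](divff f0) -mulrDl e' mul1r.
    by apply: res_pos => //; rewrite vV //; lia.
  have RN1 : R (-1) by apply/RE => //; rewrite vN1.
  have rN1 : res (-1) = -1.
    apply/eqP; rewrite -addr_eq0 -[in X in _ + X]res1 -resD // addNr; apply/eqP.
    by case: res_residue => _ _ h _; apply/h => //; split=> //; left.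
  have -> : (-1) ^ (v f * v g) * (f ^ v g / g ^ v f) = (-1) ^+ (n * n) * (g / f) ^+ n.
    rewrite vg nE mulrNN -PoszM; congr (_ * _).
    by rewrite -!exprnN invrK expr_div_n mulrC.
  have [RA EA] := resX n Rgf; have [RB EB] := resX (n * n) RN1.
  rewrite resM // EB EA.
  rewrite rN1 rgf -exprD -signr_odd oddD oddM andbb addbb expr0 //.
- have [vg rg] := steinberg_pos f0 g0 e vf.
  have Rg : R g by apply/RE => //; rewrite vg.
  rewrite vg mulr0 !expr0z !mul1r; set n := `|v f|%N.
  have -> : v f = n%:Z by rewrite /n; lia.
  rewrite -exprnP; have [RA EA] := resX n Rg.
  have gn0 : g ^+ n != 0 by rewrite expf_neq0.
  have RB : R (g ^+ n)^-1 by apply/RE; rewrite ?invr_eq0 // vV // vX // vg mul0r oppr0.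
  by have := resM RA RB; rewrite divff // res1 EA rg expr1n mul1r.
rewrite vf mul0r !expr0z mul1r invr1 mulr1.
have h := tri' f0 g0 e; have {h} vg : 0 <= v g by move: h; rewrite vf; lia.
set n := `|v g|%N; have nE : v g = n%:Z by rewrite /n; lia.
have Rf : R f by apply/RE => //; rewrite vf.
rewrite nE -exprnP; have [RA ->] := resX n Rf.
case: (posnP n) => [->|n0]; first by rewrite expr0.
have /(steinberg_pos g0 f0 e') [_ ->] : 0 < v g by rewrite nE; lia.
by rewrite expr1n.
Qed.

Let resT_mul (f f' g g' h h' : K) : f != 0 -> f' != 0 -> g != 0 -> g' != 0 -> h != 0 -> h' != 0 ->
  T h h' = T f g * T f' g' ->
  to_mg (tame_formula v res h h') =
  to_mg (tame_formula v res f g) + to_mg (tame_formula v res f' g').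
Proof.
move=> f0 f'0 g0 g'0 h0 h'0 e; apply: val_inj.
rewrite val_mgD !val_to_mg; try exact: T_neq0.
by rewrite /tame_formula -!/(T _ _) e resM //; apply: RT.
Qed.

Lemma tame_kills z :
  K2_rels z ->
  freeg_lift (fun fg => to_mg (tame_formula v res (val fg.1) (val fg.2))) z = 0.
Proof.
have nz := @mg_neq0 K.
move=> [[[a [a' [b ->]]]|[a [b [b' ->]]]]|[a [b [e ->]]]];
  rewrite ?freeg_liftB ?freeg_liftU.
- rewrite (@resT_mul (val a) (val a') (val b) (val b)) ?nz //; last first.
    by rewrite val_mgD TDl.
  by rewrite addrAC addrK subrr.
- rewrite (@resT_mul (val a) (val a) (val b) (val b')) ?nz //; last first.
    by rewrite val_mgD TDr.
  by rewrite addrAC addrK subrr.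
by rewrite /= steinberg ?nz //; apply: (@val_inj _ _ (mulgroup kappa)); rewrite val_to_mg ?oner_neq0.
Qed.

Lemma tameB : {morph tame v res : p q / p - q}.
Proof. exact: presented_liftB tame_kills. Qed.

Lemma tame_symbol (a b : mulgroup K) :
  tame v res (symbol a b) = to_mg (tame_formula v res (val a) (val b)).
Proof. exact: presented_lift_gen tame_kills _. Qed.

End TameHom.

Section Curves.
Context (k : fieldType) (K : fieldType) (j : {rmorphism k -> K}).
Implicit Types (C : set (set K)).

(* [K] is the function field of the affine variety in A^m over [k] with
   equations [eqs], and [t] is its generic point: k[T]/(eqs) is isomorphic to
   k[t], and K is the fraction field of k[t]. *)
Definition affine_function_field (m r : nat) (eqs : 'I_r -> {mpoly k[m]})
    (t : 'I_m -> K) : Prop :=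
  (forall P : {mpoly k[m]},
     mmap j t P = 0 <-> exists c : 'I_r -> {mpoly k[m]}, P = \sum_i c i * eqs i) /\
  (forall z, exists P Q : {mpoly k[m]},
     mmap j t Q != 0 /\ z = mmap j t P / mmap j t Q).

(* The chart x_i <> 0 of the projective model with homogeneous generic point x. *)
Definition proj_chart (m : nat) (x : 'I_m.+1 -> K) (i : 'I_m.+1) : set K :=
  adjoin (range j) (range (fun a => x a / x i)).

(* Smoothness of relative dimension 1 (Jacobian criterion) at [R], for the
   affine variety with generic point [t] in A^(m+1). *)
Definition smooth_at (m : nat) (t : 'I_m.+1 -> K) (R : set K) : Prop :=
  exists (P : 'I_m -> {mpoly k[m.+1]}) (b : 'I_m.+1),
    (forall a, mmap j t (P a) = 0) /\
    let J := \matrix_(a < m, c < m.+1) mmap j t (mderiv c (P a)) in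
    \det (col' b J) != 0 /\ R (\det (col' b J))^-1.

Definition smooth_projective_curve C : Prop :=
  (exists m (x : 'I_m.+1 -> K),
    [/\ exists i, x i != 0,
        forall i, x i != 0 -> birational (proj_chart x i),
        C = \bigcup_(i in [set i | x i != 0]) spec (proj_chart x i)
      & forall i R, x i != 0 -> spec (proj_chart x i) R ->
          smooth_at (fun a => x a / x i) R]) /\
  (forall R, closed_point C R -> krull_dim R 1).

Definition H2M C : set (K2MQ K) :=
  [set xi | forall R, closed_point C R -> killed_at R xi].

Definition integers_in : set K := j @` [set a | integralOver (intr : int -> k) a].

(* Models over the ring of integers of [k]; the generic fibre consists of the
   local rings containing [k]. *)
Definition regular_proper_model C (M : set (set K)) : Prop :=
  [/\ proper_model integers_in M, forall R, M R -> regular_local R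
    & [set R | M R /\ range j `<=` R] = C].

(* The integral part of [H2M C], computed with the model [M]. *)
Definition H2MZ C (M : set (set K)) : set (K2MQ K) :=
  H2M C `&` [set xi | forall R, closed_fibre_component integers_in M R ->
                                killed_at R xi].

End Curves.

(* [iota] identifies [k] with the subfield of the algebraic numbers generated
   over Q by [s]. *)
Definition generated_by (k : fieldExtType rat) (iota : {rmorphism k -> algC})
    (s : seq algC) : Prop :=
  exists2 s' : seq k, map iota s' = s & <<1 & s'>>%VS = fullv.

Definition Phi (n : nat) (lambda : 'I_n -> algC) : {poly algC} :=
  'X * \prod_i ('X - (lambda i)%:P) - 1.

Section Equations.
Context (k : fieldType).

(* x^N + (-1)^n y_i^N = l_i, with coordinates x = 'X_ord0, y_i = 'X_(fintype.lift ord0 i). *)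
Definition X_eqs (N n : nat) (l : 'I_n -> k) (i : 'I_n) : {mpoly k[n.+1]} :=
  'X_ord0 ^+ N + (-1) ^+ n * 'X_(fintype.lift ord0 i) ^+ N - (l i)%:MP.

Definition X_coords (K : Type) (n : nat) (x : K) (y : 'I_n -> K) (a : 'I_n.+1) : K :=
  if unlift ord0 a is Some i then y i else x.

(* Y^N = q(X), with coordinates X = 'X_0, Y = 'X_1. *)
Definition E_eqs (N : nat) (q : {poly k}) (i : 'I_1) : {mpoly k[2]} :=
  'X_(fintype.lift ord0 ord0) ^+ N - horner_alg 'X_ord0 q.

Definition E_coords (K : Type) (X Y : K) (a : 'I_2) : K := if a == ord0 then X else Y.

End Equations.

(* Main.v *)
Require Import Defs.
From HB Require Import structures.
From mathcomp Require Import all_boot all_order all_algebra all_field.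
From mathcomp Require Import boolp classical_sets zify.
From mathcomp.multinomials Require Import freeg mpoly.

Set Implicit Arguments.
Unset Strict Implicit.
Unset Printing Implicit Defensive.

Import Order.TTheory GRing.Theory Num.Theory.
Local Open Scope ring_scope.

(** Both symbols have the shape {1 - Y, x} with Y^N = q(x^e), where
    q = T prod_i (T - lambda_i) = Phi + 1.  On E_{N,n} this is the equation of
    the curve, with e = 1; on X_{N,n} it holds for Y = x y_1 ... y_n and e = N,
    by multiplying the n equations, whose signs (-1)^n cancel since n^2 + n is
    even.

    The tame symbol of {1 - Y, x} is torsion at every discrete valuation whose
    ring R contains the coefficients of q and those of a polynomial h with
    (T^M - 1)^d = (q - 1) h; hence it dies after tensoring with Q
    (symbol_killed).  The tool is tame_torsionl and its mirror image
    tame_torsionr: if f^a = g^b u, with u congruent to 1 modulo the maximal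
    ideal, then a{f,g} = b{g,g} + {u,g}, where {g,g} = {-1,g} is 2-torsion and u
    has trivial tame symbol with everything.  This covers all places
    (tame_torsion):
    - at a zero of x, T divides q, so Y vanishes and 1 - Y is itself congruent
      to 1;
    - at a pole of x, q is monic, so (1 - Y)^N is, up to sign and a factor
      congruent to 1, the power of x of exponent e deg q;
    - where x is a unit, Y is integral; either 1 - Y is a unit too, or Y reduces
      to 1, so x^e reduces to a root of q - 1 = Phi, and thus x^(eM) to 1.

    The roots of Phi being roots of unity, Phi divides some (T^M - 1)^d.  The
    quotient h has coefficients in the field of constants, which lies in the
    local ring of every closed point: this gives the motivic classes.  If Phi
    has integer coefficients then so does h, Phi being monic; as every subring
    contains Z, the tame symbol is then torsion at every discrete valuation,
    in particular at the components of the closed fibres of any model.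

    That 1 - Y and x are nonzero in the function field is checked by evaluating
    them at algebraic points of the affine curve (generic_point_neq0). *)

(** * Tame symbols at a discrete valuation *)

Section Place.
Context (K : fieldType) (R : set K) (v : K -> int).
Context (kappa : fieldType) (res : K -> kappa).
Hypotheses (v_ord : is_ord R v) (res_residue : is_residue R res).
Implicit Types f g u x z : K.

Lemma ordM f g : f != 0 -> g != 0 -> v (f * g) = v f + v g.
Proof. by case: v_ord => h _ _ _; apply: h. Qed.

Lemma ord1 : v 1 = 0.
Proof.
have /eqP := ordM (oner_neq0 K) (oner_neq0 K).
by rewrite mulr1 -subr_eq0 opprD addNKr oppr_eq0 => /eqP.
Qed.

Lemma ordV f : f != 0 -> v f^-1 = - v f.
Proof.
by move=> f0; have := ordM f0 (invr_neq0 f0); rewrite divff // ord1; lia.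
Qed.

Lemma ordX f (a : nat) : f != 0 -> v (f ^+ a) = v f * a%:Z.
Proof.
move=> f0; elim: a => [|a IH]; first by rewrite expr0 ord1 mulr0.
by rewrite exprS ordM ?expf_neq0 // IH; lia.
Qed.

Lemma ordN f : v (- f) = v f.
Proof.
have [->|f0] := eqVneq f 0; first by rewrite oppr0.
have N1 : (-1 : K) != 0 by rewrite oppr_eq0 oner_neq0.
have := ordM N1 N1; rewrite mulrNN mulr1 ord1 => vN1.
by rewrite -mulN1r ordM //; lia.
Qed.

Lemma memE f : f != 0 -> R f <-> 0 <= v f.
Proof.
case: v_ord => _ _ _ -> /= f0; split=> [[/eqP|//]|]; last by right.
by rewrite (negPf f0).
Qed.

Lemma mem0 : R 0.
Proof. by case: v_ord => _ _ _ ->; left. Qed.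

Lemma mem1 : R 1.
Proof. by apply/memE; rewrite ?oner_neq0 ?ord1. Qed.

Lemma memN f : R f -> R (- f).
Proof.
have [->|f0] := eqVneq f 0; first by rewrite oppr0.
by move/(memE f0)=> vf; apply/memE; rewrite ?oppr_eq0 ?ordN.
Qed.

Lemma memM f g : R f -> R g -> R (f * g).
Proof.
have [->|f0] := eqVneq f 0; first by rewrite mul0r.
have [->|g0] := eqVneq g 0; first by rewrite mulr0.
move=> /(memE f0) vf /(memE g0) vg.
by apply/memE; rewrite ?mulf_neq0 // ordM // addr_ge0.
Qed.

Lemma memD f g : R f -> R g -> R (f + g).
Proof.
have [->|f0] := eqVneq f 0; first by rewrite add0r.
have [->|g0] := eqVneq g 0; first by rewrite addr0.
have [->|fg0] := eqVneq (f + g) 0; first by move=> *; apply: mem0.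
move=> /(memE f0) vf /(memE g0) vg; apply/memE => //.
case: v_ord => _ /(_ f g f0 g0 fg0) h _ _; lia.
Qed.

Lemma memX f a : R f -> R (f ^+ a).
Proof.
by move=> Rf; elim: a => [|a IH]; rewrite ?expr0 ?exprS; [exact: mem1|exact: memM].
Qed.

Lemma mem_nat a : R a%:R.
Proof. by elim: a => [|a IH]; [exact: mem0 | rewrite mulrS; exact: memD mem1 IH]. Qed.

Lemma mem_int (a : int) : R a%:~R.
Proof. by case: a => a; [|rewrite NegzE mulrNz; apply: memN]; apply: mem_nat. Qed.

Lemma mem_sum (I : Type) (r : seq I) (P : pred I) (F : I -> K) :
  (forall i, P i -> R (F i)) -> R (\sum_(i <- r | P i) F i).
Proof. by move=> h; apply: (big_ind R) => //; [exact: mem0 | exact: memD]. Qed.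

Lemma mem_horner (p : {poly K}) z :
  (forall i, R p`_i) -> R z -> R p.[z].
Proof.
move=> Rp Rz; rewrite horner_coef; apply: mem_sum => i _.
by apply: memM => //; apply: memX.
Qed.

Lemma res1 : res 1 = 1.
Proof. by case: res_residue => -[]. Qed.

Lemma resD f g : R f -> R g -> res (f + g) = res f + res g.
Proof. by case: res_residue => -[_ h] _ _ _; apply: h. Qed.

Lemma resM f g : R f -> R g -> res (f * g) = res f * res g.
Proof. by case: res_residue => _ h _ _; apply: h. Qed.

Lemma resX f a : R f -> res (f ^+ a) = res f ^+ a.
Proof.
move=> Rf; elim: a => [|a IH]; first by rewrite !expr0 res1.
by rewrite !exprS resM ?IH //; apply: memX.
Qed.

Lemma res_eq0 f : f != 0 -> R f -> (res f = 0) <-> 0 < v f.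
Proof.
move=> f0 Rf; have f'0 : f^-1 != 0 by rewrite invr_eq0.
case: res_residue => _ _ /(_ f Rf) h _; apply: iff_trans h _.
have := memE f'0; rewrite ordV // => E; split.
  move=> [_ [/eqP|nR]]; first by rewrite (negPf f0).
  by rewrite ltNge; apply/negP => vf; apply: nR; apply/E; lia.
by move=> vf; split=> //; right=> /E; lia.
Qed.

Lemma res0 : res 0 = 0.
Proof.
by case: res_residue => _ _ /(_ 0 mem0) h _; apply/h; split; [exact: mem0|left].
Qed.

Lemma resN f : R f -> res (- f) = - res f.
Proof.
by move=> Rf; apply/eqP; rewrite -addr_eq0 -resD ?addNr ?res0 //; apply: memN.
Qed.

(** The maximal ideal, in the form suited to computing with [res]. *)
Definition maximal z := R z /\ res z = 0.

Lemma maximal0 : maximal 0.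
Proof. by split; [exact: mem0 | exact: res0]. Qed.

Lemma maximal_ord z : 0 < v z -> maximal z.
Proof.
have [->|z0] := eqVneq z 0; first by move=> _; exact: maximal0.
move=> vz; have Rz : R z by apply/memE => //; lia.
by split=> //; apply/res_eq0.
Qed.

Lemma maximalD x z : maximal x -> maximal z -> maximal (x + z).
Proof.
by move=> [Rx x0] [Rz z0]; split; [exact: memD | rewrite resD // x0 z0 addr0].
Qed.

Lemma maximalN z : maximal z -> maximal (- z).
Proof. by move=> [Rz z0]; split; [exact: memN | rewrite resN // z0 oppr0]. Qed.

Lemma maximalMl x z : R x -> maximal z -> maximal (x * z).
Proof.
by move=> Rx [Rz z0]; split; [exact: memM | rewrite resM // z0 mulr0].
Qed.

Lemma maximal_expI z a : R z -> maximal (z ^+ a) -> maximal z.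
Proof.
move=> Rz [_]; rewrite resX // => /eqP; rewrite expf_eq0 => /andP[_ /eqP z0].
by split.
Qed.

(** Elements of 1 + m, the kernel of reduction on units. *)
Definition principal_unit u := R u /\ res u = 1.

Lemma principal_unit1D z : maximal z -> principal_unit (1 + z).
Proof.
move=> [Rz z0]; split; first exact: memD mem1 Rz.
by rewrite resD // ?res1 ?z0 ?addr0 //; exact: mem1.
Qed.

Lemma principal_unit_neq0 u : principal_unit u -> u != 0.
Proof.
by move=> [_ u1]; apply/eqP => u0; move: u1 (oner_neq0 kappa); rewrite u0 res0 => <- /eqP.
Qed.

Lemma principal_unit_ord u : principal_unit u -> v u = 0.
Proof.
move=> pu; have u0 := principal_unit_neq0 pu; case: pu => Ru u1.
have := res_eq0 u0 Ru; have /(memE u0) := Ru; rewrite u1 => vu [_ h].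
have : ~ (0 < v u) by move/h => /eqP; rewrite oner_eq0.
lia.
Qed.

Lemma principal_unitM u w :
  principal_unit u -> principal_unit w -> principal_unit (u * w).
Proof.
by move=> [Ru u1] [Rw w1]; split; [exact: memM | rewrite resM // u1 w1 mulr1].
Qed.

Lemma principal_unitV u : principal_unit u -> principal_unit u^-1.
Proof.
move=> pu; have u0 := principal_unit_neq0 pu; have vu := principal_unit_ord pu.
have Ru' : R u^-1 by apply/memE; rewrite ?invr_eq0 // ordV // vu.
split=> //; case: pu => Ru u1.
by rewrite -[LHS]mul1r -u1 -resM // divff // res1.
Qed.

Lemma principal_unitX u a : principal_unit u -> principal_unit (u ^+ a).
Proof.
by move=> [Ru u1]; split; [exact: memX | rewrite resX // u1 expr1n].
Qed.

Lemma principal_unitXz u (a : int) : principal_unit u -> principal_unit (u ^ a).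
Proof.
move=> pu; case: a => a; first exact: principal_unitX.
by rewrite NegzE -exprnN; apply/principal_unitV/principal_unitX.
Qed.

Lemma ordXz f (a : int) : f != 0 -> v (f ^ a) = v f * a.
Proof.
move=> f0; case: a => a; first exact: ordX.
by rewrite NegzE -exprnN ordV ?expf_neq0 // ordX // mulrN.
Qed.

Lemma tame_formulaX f g a : f != 0 -> g != 0 ->
  tame_formula v res f g ^+ a =
  res (((-1) ^ (v f * v g) * (f ^ v g / g ^ v f)) ^+ a).
Proof.
move=> f0 g0; rewrite resX //.
have nz := expfz_neq0; have N1 : (-1 : K) != 0 by rewrite oppr_eq0 oner_neq0.
apply/memE; rewrite ?mulf_neq0 ?invr_eq0 ?nz //.
by rewrite !ordM ?mulf_neq0 ?invr_eq0 ?nz // ordV ?nz // !ordXz // ordN ord1; lia.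
Qed.

(** In K_2, a{f,g} = b{g,g} + {u,g}.  The factor 2 kills the sign {g,g} = {-1,g},
    and the tame symbol of {u,g} is a power of the residue of u.  On
    representatives the tame symbol to the power 2a is the residue of
    u^(2 ord g). *)
Lemma tame_torsionl f g u (a b : nat) : f != 0 -> g != 0 ->
  principal_unit u -> f ^+ a = g ^+ b * u ->
  tame_formula v res f g ^+ (2 * a) = 1.
Proof.
move=> f0 g0 pu E; have u0 := principal_unit_neq0 pu.
have vE : v f * a%:Z = v g * b%:Z.
  have := congr1 v E; rewrite ordX // ordM ?expf_neq0 // ordX //.
  by rewrite (principal_unit_ord pu) addr0.
rewrite tame_formulaX //; set T := _ ^+ _.
suff -> : T = u ^ (v g * 2) by case: (principal_unitXz (v g * 2) pu).
rewrite /T exprMn expr_div_n !exprnP !exprz_exp.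
have -> : v f * v g * (2 * a)%N%:Z = 2 * (v f * v g * a) by lia.
rewrite -exprz_exp -[(-1) ^ 2]exprnP sqrrN expr1n exp1rz mul1r.
have -> : v g * (2 * a)%N%:Z = a%:Z * (v g * 2) by lia.
have -> : v f * (2 * a)%N%:Z = b%:Z * (v g * 2) by lia.
move: (v g * 2) => c; rewrite -!exprz_exp -!exprnP E expfzMl mulrAC divff ?mul1r //.
by rewrite expfz_neq0 // expf_neq0.
Qed.

(** The previous lemma with the two entries exchanged: here the power 2a is the
    residue of u^(- 2 ord f). *)
Lemma tame_torsionr f g u (a b : nat) : f != 0 -> g != 0 ->
  principal_unit u -> g ^+ a = f ^+ b * u ->
  tame_formula v res f g ^+ (2 * a) = 1.
Proof.
move=> f0 g0 pu E; have u0 := principal_unit_neq0 pu.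
have vE : v g * a%:Z = v f * b%:Z.
  have := congr1 v E; rewrite ordX // ordM ?expf_neq0 // ordX //.
  by rewrite (principal_unit_ord pu) addr0.
rewrite tame_formulaX //; set T := _ ^+ _.
suff -> : T = u ^ (- (v f * 2)) by case: (principal_unitXz (- (v f * 2)) pu).
rewrite /T exprMn expr_div_n !exprnP !exprz_exp.
have -> : v f * v g * (2 * a)%N%:Z = 2 * (v f * v g * a) by lia.
rewrite -exprz_exp -[(-1) ^ 2]exprnP sqrrN expr1n exp1rz mul1r.
have -> : v g * (2 * a)%N%:Z = b%:Z * (v f * 2) by lia.
have -> : v f * (2 * a)%N%:Z = a%:Z * (v f * 2) by lia.
move: (v f * 2) => c; rewrite -!exprz_exp -!exprnP E expfzMl invfM mulrA divff ?mul1r ?invr_expz //.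
by rewrite expfz_neq0 // expf_neq0.
Qed.


Lemma maximal_sum (I : Type) (r : seq I) (P : pred I) (F : I -> K) :
  (forall i, P i -> maximal (F i)) -> maximal (\sum_(i <- r | P i) F i).
Proof.
by move=> h; apply: (big_ind maximal) => //; [exact: maximal0 | exact: maximalD].
Qed.

Lemma mem_expI z a : (0 < a)%N -> R (z ^+ a) -> R z.
Proof.
move=> a0; have [->|z0] := eqVneq z 0; first by move=> _; apply: mem0.
move/(memE (expf_neq0 a z0)); rewrite ordX // => h; apply/memE => //; nia.
Qed.

(** At a pole of z the leading term dominates. *)
Lemma monic_horner_pole (p : {poly K}) z :
  p \is monic -> (forall i, R p`_i) -> z != 0 -> maximal z^-1 ->
  exists2 u, principal_unit u & p.[z] = z ^+ (size p).-1 * u.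
Proof.
move=> mp Rp z0 mz; set d := (size p).-1.
exists (1 + \sum_(i < d) p`_i * z^-1 ^+ (d - i)).
  apply/principal_unit1D/maximal_sum => i _; apply: maximalMl => //.
  have -> : (d - i = (d - i).-1.+1)%N by have := ltn_ord i; lia.
  by rewrite exprSr; apply: maximalMl => //; apply: memX; case: mz.
have sp : size p = d.+1 by rewrite prednK // size_poly_gt0 monic_neq0.
rewrite horner_coef sp big_ord_recr /= (_ : p`_d = 1); last exact/eqP.
rewrite mul1r mulrDr mulr1 addrC; congr (_ + _); rewrite mulr_sumr.
apply: eq_bigr => i _; rewrite mulrCA; congr (_ * _).
have id := ltnW (ltn_ord i).
by rewrite exprVn -{2}(subnKC id) exprD mulfK // expf_neq0.
Qed.

Lemma horner_maximal (p : {poly K}) z :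
  p`_0 = 0 -> (forall i, R p`_i) -> maximal z -> maximal p.[z].
Proof.
move=> p0 Rp mz; rewrite horner_coef; apply: maximal_sum => -[[|i] lti] _ /=.
  by rewrite p0 mul0r; exact: maximal0.
apply: maximalMl => //; rewrite exprSr; apply: maximalMl => //.
by apply: memX; case: mz.
Qed.

(** The three cases are a pole, a zero and a unit value of x.  In the
    last one, roots of unity enter through the identity for (T^M - 1)^d, which
    reduces modulo the maximal ideal in every residue characteristic, whereas
    the roots of q - 1 need not lie in K. *)
Lemma tame_torsion (N e M d : nat) (q h : {poly K}) (x Y : K) :
  (0 < N)%N -> (0 < e)%N -> (0 < M)%N ->
  q \is monic -> (1 < size q)%N -> q`_0 = 0 ->
  (forall i, R q`_i) -> (forall i, R h`_i) ->
  ('X^M - 1) ^+ d = (q - 1) * h ->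
  Y ^+ N = q.[x ^+ e] -> x != 0 -> 1 - Y != 0 ->
  exists2 a, (0 < a)%N & tame_formula v res (1 - Y) x ^+ a = 1.
Proof.
move=> N0 e0 M0 mq sq q0 Rq Rh hqh YN x0 f0.
case: (ltgtP (v x) 0) => vx.
- set D := (size q).-1; have D0 : (0 < D)%N by rewrite /D; lia.
  have [u pu qE] : exists2 u, principal_unit u & q.[x ^+ e] = (x ^+ e) ^+ D * u.
    apply: monic_horner_pole; rewrite ?expf_neq0 //; apply: maximal_ord.
    by rewrite ordV ?expf_neq0 // ordX //; nia.
  have YE : Y ^+ N = x ^+ (e * D) * u by rewrite YN qE -exprM.
  have u0 := principal_unit_neq0 pu.
  have Y0 : Y != 0.
    have : Y ^+ N != 0 by rewrite YE mulf_neq0 ?expf_neq0.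
    by rewrite expf_eq0 N0.
  have vY : v Y < 0.
    have := congr1 v YE; rewrite ordM ?expf_neq0 // !ordX //.
    by rewrite (principal_unit_ord pu) addr0 => ?; nia.
  have pw : principal_unit (1 + - Y^-1).
    by apply/principal_unit1D/maximalN/maximal_ord; rewrite ordV //; lia.
  have fE : 1 - Y = - (Y * (1 + - Y^-1)).
    by rewrite mulrDr mulr1 mulrN divff // opprD opprK addrC.
  (* The second factor 2 absorbs the sign of (1 - Y)^N = +- Y^N (1 - Y^-1)^N. *)
  exists (2 * (N * 2))%N; first by lia.
  apply: (@tame_torsionl _ _ (u ^+ 2 * (1 + - Y^-1) ^+ (N * 2)) _ (e * D * 2)) => //.
    by apply: principal_unitM; apply: principal_unitX.
  rewrite {1}fE exprNn mulnC exprM sqrrN expr1n expr1n mul1r mulnC.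
  by rewrite exprMn exprM YE exprMn -exprM mulrA.
- have mY : maximal Y.
    have mYN : maximal (Y ^+ N).
      rewrite YN; apply: horner_maximal => //; apply: maximal_ord.
      by rewrite ordX //; nia.
    apply: maximal_expI (mYN).
    by case: mYN => RYN _; apply: mem_expI N0 RYN.
  exists (2 * 1)%N => //; apply: (@tame_torsionl _ _ (1 - Y) _ 0) => //.
    exact/principal_unit1D/maximalN.
  by rewrite expr1 mul1r.
have Rxe : R (x ^+ e) by apply/memE; rewrite ?expf_neq0 // ordX // vx mul0r.
have RY : R Y by apply: mem_expI N0 _; rewrite YN; apply: mem_horner.
have /(memE f0) vf := memD mem1 (memN RY).
case: (ltgtP (v (1 - Y)) 0) => vf'; first by move: vf vf'; lia.
- have mY1 : maximal (Y - 1) by rewrite -opprB; apply/maximalN/maximal_ord.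
  have mYN1 : maximal (Y ^+ N - 1).
    rewrite subrX1 mulrC; apply: maximalMl => //; apply: mem_sum => i _.
    exact: memX.
  have mx : maximal ((x ^+ e) ^+ M - 1).
    apply: (@maximal_expI _ d).
      by apply: memD (memX _ Rxe) (memN mem1).
    have := congr1 (fun p : {poly K} => p.[x ^+ e]) hqh.
    rewrite horner_exp hornerM !hornerE -YN => ->.
    by rewrite mulrC; apply: maximalMl => //; apply: mem_horner.
  exists (2 * (e * M))%N; first by nia.
  apply: (@tame_torsionr _ _ (1 + (x ^+ (e * M) - 1)) _ 0) => //.
    by apply: principal_unit1D; rewrite exprM.
  by rewrite expr0 mul1r addrC subrK.
by exists 1%N => //; rewrite /tame_formula vx vf' mul0r !expr0z divr1 mulr1 res1.
Qed.

End Place.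

(** * Torsion dies in the tensor product with the rationals *)

Section TensorTorsion.
Context (A B : zmodType).

Lemma tensDl (a a' : A) (b : B) : tens (a + a') b = tens a b + tens a' b.
Proof.
apply/eqP; rewrite -subr_eq0 opprD addrA; apply/eqP.
rewrite /tens /presented_gen -!raddfB; apply: tens_relator.
by left; exists a, a', b.
Qed.

Lemma tensDr (a : A) (b b' : B) : tens a (b + b') = tens a b + tens a b'.
Proof.
apply/eqP; rewrite -subr_eq0 opprD addrA; apply/eqP.
rewrite /tens /presented_gen -!raddfB; apply: tens_relator.
by right; exists a, b, b'.
Qed.

Lemma tens0l (b : B) : tens (0 : A) b = 0.
Proof.
by have /eqP := tensDl 0 0 b; rewrite addr0 -subr_eq0 opprD addNKr oppr_eq0 => /eqP.
Qed.

Lemma tens0r (a : A) : tens a (0 : B) = 0.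
Proof.
by have /eqP := tensDr a 0 0; rewrite addr0 -subr_eq0 opprD addNKr oppr_eq0 => /eqP.
Qed.

Lemma tensMnl (a : A) (b : B) c : tens (a *+ c) b = tens a b *+ c.
Proof. by elim: c => [|c IH]; rewrite ?mulr0n ?tens0l // !mulrS tensDl IH. Qed.

Lemma tensMnr (a : A) (b : B) c : tens a (b *+ c) = tens a b *+ c.
Proof. by elim: c => [|c IH]; rewrite ?mulr0n ?tens0r // !mulrS tensDr IH. Qed.

End TensorTorsion.

(** Divide the rational by c and move c across the tensor sign. *)
Lemma tens_torsion (A : zmodType) (a : A) (r : rat) c :
  (0 < c)%N -> a *+ c = 0 -> tens a r = 0.
Proof.
move=> c0 ac; have -> : r = (r / c%:R) *+ c.
  by rewrite -mulr_natr divfK // pnatr_eq0 -lt0n.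
by rewrite tensMnr -tensMnl ac tens0l.
Qed.

Lemma val_mgX (F : fieldType) (a : mulgroup F) c : val (a *+ c) = val a ^+ c.
Proof. by elim: c => // c IH; rewrite mulrS val_mgD IH exprS. Qed.

Lemma symbol_killed (K : fieldType) (R : set K) (a b : mulgroup K) (r : rat) :
  (forall (v : K -> int) (kappa : fieldType) (res : K -> kappa),
     is_ord R v -> is_residue R res ->
     exists2 c, (0 < c)%N & tame_formula v res (val a) (val b) ^+ c = 1) ->
  killed_at R (tens (symbol a b) r).
Proof.
move=> tors v kappa res vo rr; have [c c0 tc] := tors v kappa res vo rr.
rewrite /tameQ tensor_mapl_tens; last exact: tameB vo rr.
rewrite (tame_symbol vo rr); apply: (tens_torsion _ c0); apply: val_inj.
rewrite val_mgX val_to_mg //; apply/eqP => t0; move/eqP: tc.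
by rewrite t0 expr0n gtn_eqF // eq_sym oner_eq0.
Qed.

(** * Polynomials whose roots are roots of unity *)

(** Multiplicities are absorbed by the power [size rs], and M is the product of
    the exponents of the roots, so that each T - z divides T^M - 1. *)
Lemma prod_XsubC_dvd_unity (F : fieldType) (rs : seq F) :
  (forall z, z \in rs -> exists2 m, (0 < m)%N & z ^+ m = 1) ->
  exists2 M, (0 < M)%N & \prod_(z <- rs) ('X - z%:P) %| ('X^M - 1) ^+ size rs.
Proof.
elim: rs => [|z rs IH] unity; first by exists 1%N => //; rewrite big_nil dvd1p.
have [|M M0 dM] := IH; first by move=> t trs; apply: unity; rewrite inE trs orbT.
have [m m0 zm] := unity z (mem_head _ _).
exists (M * m)%N; first by rewrite muln_gt0 M0.
rewrite big_cons /= exprS dvdp_mul //.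
  by rewrite dvdp_XsubCl rootE !hornerE mulnC exprM zm expr1n subrr.
apply: dvdp_trans dM _; apply: dvdp_exp2r.
by rewrite exprM [X in _ %| X]subrX1 dvdp_mulr.
Qed.

Lemma dvd_unity (p : {poly algC}) : p \is monic ->
  (forall z, root p z -> exists2 m, (0 < m)%N & z ^+ m = 1) ->
  exists M d, (0 < M)%N /\ p %| ('X^M - 1) ^+ d.
Proof.
move=> mp unity; have [rs pE] := closed_field_poly_normal p.
move: pE; rewrite (eqP mp) scale1r => pE.
have [z zrs|M M0 dM] := @prod_XsubC_dvd_unity _ rs.
  by apply: unity; rewrite pE root_prod_XsubC.
by exists M, (size rs); rewrite pE.
Qed.

(** Euclidean division by a monic polynomial is already possible over the
    integers, and its remainder is the one over F. *)
Lemma monic_int_dvd (F : numFieldType) (p a : {poly int}) : p \is monic ->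
  map_poly (intr : int -> F) p %| map_poly intr a -> exists h, a = p * h.
Proof.
move=> mp dvd; have aE := Pdiv.RingMonic.rdivp_eq mp a.
set d := Pdiv.CommonRing.rdivp a p in aE; set r := Pdiv.CommonRing.rmodp a p in aE.
exists d; rewrite {}aE in dvd *.
have mapI := @map_inj_poly _ _ (intr : int -> F) (@intr_inj F) (mulr0z 1).
suff r0 : r = 0 by rewrite r0 addr0 mulrC.
apply: mapI; rewrite map_poly0.
move: dvd; rewrite rmorphD rmorphM /= dvdp_addr ?dvdp_mull // => dvd.
apply/eqP; apply: contraTT dvd => r0.
rewrite gtNdvdp // !size_map_inj_poly //; try exact: intr_inj.
by rewrite Pdiv.CommonRing.ltn_rmodp monic_neq0.
Qed.

(** * A criterion for {1 - Y, x} to be a motivic class *)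

Lemma curve_point_scalars (k K : fieldType) (j : {rmorphism k -> K})
    (C : set (set K)) R :
  smooth_projective_curve j C -> closed_point C R -> forall c, R (j c).
Proof.
move=> [[m [t [_ _ CE _]]] _] [CR _] c; move: CR; rewrite CE.
move=> [i _ [p [pp ->]]].
have Aj c' : proj_chart j t i (j c').
  by move=> G [_ sG]; apply: sG; left; exists c'.
exists (j c), 1; split; rewrite ?divr1 //; last by case: pp.
by rewrite -(rmorph1 j).
Qed.

Section Criterion.
Context (k K : fieldType) (iota : {rmorphism k -> algC}) (j : {rmorphism k -> K}).
Context (C : set (set K)) (q : {poly k}) (N e : nat) (x Y : K).
Hypothesis C_curve : smooth_projective_curve j C.
Hypotheses (N_gt0 : (0 < N)%N) (e_gt0 : (0 < e)%N).
Hypotheses (q_monic : q \is monic) (size_q : (1 < size q)%N) (q0 : q`_0 = 0).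
Hypothesis unity : forall z : algC, root (map_poly iota q - 1) z ->
  exists2 m, (0 < m)%N & z ^+ m = 1.
Hypothesis curve_eq : Y ^+ N = (map_poly j q).[x ^+ e].
Hypotheses (x_neq0 : x != 0) (f_neq0 : 1 - Y != 0).

Let Phi_monic : q - 1 \is monic.
Proof.
rewrite monicE lead_coefDl ?(eqP q_monic) //.
by rewrite size_polyN size_poly1.
Qed.

Let tame_torsion_of_cofactor M d (h : {poly K}) (R : set K) v (kappa : fieldType) (res : K -> kappa) :
  (0 < M)%N -> (forall i, R (j q`_i)) -> (forall i, R h`_i) ->
  ('X^M - 1) ^+ d = (map_poly j q - 1) * h ->
  is_ord R v -> is_residue R res ->
  exists2 a, (0 < a)%N & tame_formula v res (1 - Y) x ^+ a = 1.
Proof.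
move=> M0 Rq Rh hE vo rr.
have qj0 : (map_poly j q)`_0 = 0 by rewrite coef_map /= q0 rmorph0.
have Rqj i : R (map_poly j q)`_i by rewrite coef_map /=; apply: Rq.
apply: (tame_torsion vo rr N_gt0 e_gt0 M0 _ _ qj0 Rqj Rh hE curve_eq) => //.
  by rewrite map_monic.
by rewrite size_map_poly.
Qed.

Let symbol_inE (H : set (K2MQ K)) :
  H (tens (symbol (to_mg (1 - Y)) (to_mg x)) (1 : rat)) -> symbol_in H (1 - Y) x.
Proof. by exists (to_mg (1 - Y)), (to_mg x); rewrite !val_to_mg. Qed.

(** The cofactor h may be taken over the field of constants, because divisibility
    of polynomials does not change under field extensions. *)
Lemma symbol_in_H2M : symbol_in (H2M C) (1 - Y) x.
Proof.
apply: symbol_inE => R CR; apply: symbol_killed => v kappa res vo rr.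
rewrite !val_to_mg //; have Rj := curve_point_scalars C_curve CR.
have [|M [d [M0]]] := @dvd_unity (map_poly iota (q - 1)) (monic_map iota Phi_monic).
  by rewrite rmorphB rmorph1.
have -> : ('X^M - 1) ^+ d = map_poly iota (('X^M - 1) ^+ d).
  by rewrite rmorphXn rmorphB rmorph1 /= map_polyXn.
rewrite dvdp_map => /dvdpP[h hE].
have Rh i : R (map_poly j h)`_i by rewrite coef_map /=; apply: Rj.
apply: (tame_torsion_of_cofactor M0 _ Rh _ vo rr) => [i|]; first exact: Rj.
rewrite -(rmorph1 (map_poly j)) -rmorphB -rmorphM mulrC -hE.
by rewrite rmorphXn rmorphB rmorph1 /= map_polyXn.
Qed.

(** An integral cofactor has coefficients in every ring, so the tame symbol is
    torsion at every discrete valuation of K, hence at the components of the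
    closed fibres of [MC]. *)
Lemma symbol_in_H2MZ (MC : set (set K)) :
  map_poly iota q - 1 \is a polyOver (Num.int : {pred algC}) ->
  symbol_in (H2MZ j C MC) (1 - Y) x.
Proof.
move=> /floorpP[p pE]; have [a [b [af bx H2]]] := symbol_in_H2M.
exists a, b; split=> //; split=> // R _.
apply: symbol_killed => v kappa res vo rr; rewrite af bx.
have intE (L : fieldType) (phi : {rmorphism k -> L}) (r : {poly int}) :
    map_poly phi (map_poly intr r) = map_poly intr r.
  by rewrite -map_poly_comp; apply: eq_map_poly => c /=; rewrite rmorph_int.
have qE : q - 1 = map_poly intr p.
  by apply: (map_poly_inj iota); rewrite intE -pE rmorphB rmorph1.
have pm : p \is monic.
  have := monic_map iota Phi_monic; rewrite qE intE !monicE.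
  by rewrite (lead_coef_map_inj (@intr_inj algC) (mulr0z 1)) -[1]/(1%:~R)
    (inj_eq (@intr_inj algC)).
have [|M [d [M0]]] := @dvd_unity (map_poly iota (q - 1)) (monic_map iota Phi_monic).
  by rewrite rmorphB rmorph1.
have -> : ('X^M - 1) ^+ d = map_poly intr (('X^M - 1) ^+ d) :> {poly algC}.
  by rewrite rmorphXn rmorphB rmorph1 /= map_polyXn.
rewrite qE intE => /(monic_int_dvd pm)[h hE].
have Rj (r : {poly int}) i : R (map_poly intr r)`_i.
  by rewrite coef_map /=; apply: (mem_int vo).
have qjE : map_poly j q - 1 = map_poly intr p.
  by rewrite -(intE _ j) -qE rmorphB rmorph1.
apply: (tame_torsion_of_cofactor M0 _ (Rj h) _ vo rr) => [i|].
  rewrite -coef_map -[map_poly j q](subrK 1) qjE coefD coef1.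
  by apply: (memD vo) => //; apply: (mem_nat vo).
by rewrite qjE -rmorphM -hE rmorphXn rmorphB rmorph1 /= map_polyXn.
Qed.

End Criterion.

(** * The function fields of the two curves *)

Lemma generic_point_root (k K : fieldType) (j : {rmorphism k -> K}) m r
    (eqs : 'I_r -> {mpoly k[m]}) (t : 'I_m -> K) i :
  affine_function_field j eqs t -> mmap j t (eqs i) = 0.
Proof.
move=> [/(_ (eqs i)) [_ h] _]; apply: h; exists (fun i' => (i' == i)%:R).
rewrite (bigD1 i) //= eqxx mul1r big1 ?addr0 // => i' /negPf->.
by rewrite mul0r.
Qed.

(** A function vanishing at the generic point lies in the ideal of the equations,
    hence vanishes at every point of the variety over every extension L. *)
Lemma generic_point_neq0 (k K L : fieldType) (j : {rmorphism k -> K})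
    (iota : {rmorphism k -> L}) m r (eqs : 'I_r -> {mpoly k[m]})
    (t : 'I_m -> K) (s : 'I_m -> L) (P : {mpoly k[m]}) :
  affine_function_field j eqs t -> (forall i, mmap iota s (eqs i) = 0) ->
  mmap iota s P != 0 -> mmap j t P != 0.
Proof.
move=> [/(_ P) [h _] _] s0; apply: contra_neq => /h[c ->].
by rewrite rmorph_sum big1 // => i _; rewrite rmorphM /= s0 mulr0.
Qed.

Lemma mmap_horner_alg (k K : fieldType) (j : {rmorphism k -> K}) m
    (t : 'I_m -> K) (P : {mpoly k[m]}) (q : {poly k}) :
  mmap j t (horner_alg P q) = (map_poly j q).[mmap j t P].
Proof.
elim/poly_ind: q => [|q c IH]; first by rewrite !rmorph0 horner0.
rewrite !rmorphD !rmorphM /= IH horner_algX horner_algC mmapZ rmorph1 mulr1.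
by rewrite map_polyX map_polyC !hornerE.
Qed.

Section RootProduct.
Context (n : nat) (lambda : 'I_n -> algC) (k : fieldType).
Context (iota : {rmorphism k -> algC}) (q : {poly k}).
Hypothesis qE : map_poly iota q = 'X * \prod_i ('X - (lambda i)%:P).

Lemma root_product_monic : q \is monic.
Proof.
rewrite -(map_monic iota) qE monicMl ?monicX //.
exact: monic_prod_XsubC.
Qed.

Lemma root_product_size : size q = n.+2.
Proof.
have mp := monic_prod_XsubC (index_enum 'I_n) xpredT lambda.
rewrite -(size_map_poly iota) qE mulrC size_mulX ?monic_neq0 //.
by rewrite size_prod_XsubC /index_enum -enumT size_enum_ord.
Qed.

Lemma root_product_coef0 : q`_0 = 0.
Proof.
by apply: (fmorph_inj iota); rewrite -coef_map qE coefXM rmorph0.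
Qed.

End RootProduct.

Lemma mmap_X_eqs (k K : fieldType) (j : {rmorphism k -> K}) N n (l : 'I_n -> k)
    (x : K) (y : 'I_n -> K) i :
  mmap j (X_coords x y) (X_eqs N l i) = x ^+ N + (-1) ^+ n * y i ^+ N - j (l i).
Proof.
rewrite /X_eqs rmorphB rmorphD rmorphM !rmorphXn rmorphN1 /= mmapC !mmapX !mmap1U.
by rewrite /X_coords unlift_none liftK.
Qed.

(** The signs multiply to (-1)^(n(n+1)) = 1. *)
Lemma X_curve_eq (F : fieldType) (N n : nat) (l : 'I_n -> F) (x : F) (y : 'I_n -> F) :
  (forall i, x ^+ N + (-1) ^+ n * y i ^+ N - l i = 0) ->
  (x * \prod_i y i) ^+ N = ('X * \prod_i ('X - (l i)%:P)).[x ^+ N].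
Proof.
move=> xy; rewrite exprMn !hornerE horner_prod -prodrXl; congr (_ * _).
have yE i : x ^+ N - l i = (-1) ^+ n.+1 * y i ^+ N.
  by apply/eqP; rewrite exprS mulN1r mulNr -addr_eq0 addrAC xy.
under [RHS]eq_bigr => i _ do rewrite !hornerE yE.
rewrite big_split /= prodr_const card_ord -exprM -signr_odd oddM /=.
by rewrite andNb expr0 mul1r.
Qed.

Lemma mmap_E_eqs (k K : fieldType) (j : {rmorphism k -> K}) N (q : {poly k})
    (X Y : K) i :
  mmap j (E_coords X Y) (E_eqs N q i) = Y ^+ N - (map_poly j q).[X].
Proof.
by rewrite /E_eqs rmorphB rmorphXn /= mmap_horner_alg !mmapX !mmap1U.
Qed.

(** The point [pt a] of the curve lies above x = a; x does not vanish at
    [pt 1], nor does 1 - x y_1 ... y_n at [pt 0]. *)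
Lemma X_symbol_neq0 N n (k K : fieldType) (iota : {rmorphism k -> algC})
    (j : {rmorphism k -> K}) (l : 'I_n -> k) (x : K) (y : 'I_n -> K) :
  (0 < N)%N -> affine_function_field j (X_eqs N l) (X_coords x y) ->
  x != 0 /\ 1 - x * \prod_i y i != 0.
Proof.
move=> N0 aff.
pose pt (a : algC) := X_coords a
  (fun i => N.-root ((-1) ^+ n * (iota (l i) - a ^+ N))).
have ptE a i : mmap iota (pt a) (X_eqs N l i) = 0.
  rewrite mmap_X_eqs rootCK // mulrA -exprMn mulrNN mulr1 expr1n mul1r.
  by rewrite [X in X - _]addrC subrK subrr.
split.
  have -> : x = mmap j (X_coords x y) 'X_ord0.
    by rewrite mmapX mmap1U /X_coords unlift_none.
  apply: (generic_point_neq0 aff (ptE 1)).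
  by rewrite mmapX mmap1U /pt /X_coords unlift_none oner_neq0.
pose P : {mpoly k[n.+1]} := 1 - 'X_ord0 * \prod_i 'X_(fintype.lift ord0 i).
have PE (L : fieldType) (phi : {rmorphism k -> L}) (a : L) b :
    mmap phi (X_coords a b) P = 1 - a * \prod_i b i.
  rewrite /P rmorphB rmorph1 rmorphM rmorph_prod /= mmapX mmap1U.
  rewrite /X_coords unlift_none; congr (1 - _ * _); apply: eq_bigr => i _.
  by rewrite mmapX mmap1U liftK.
rewrite -(PE _ j); apply: (generic_point_neq0 aff (ptE 0)).
by rewrite PE mul0r subr0 oner_neq0.
Qed.

(** The point [pt a] of the curve lies above X = a.  As q(0) = 0, the coordinate
    Y vanishes at [pt 0]. *)
Lemma E_symbol_neq0 N (k K : fieldType) (iota : {rmorphism k -> algC})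
    (j : {rmorphism k -> K}) (q : {poly k}) (X Y : K) :
  (0 < N)%N -> q`_0 = 0 -> affine_function_field j (E_eqs N q) (E_coords X Y) ->
  X != 0 /\ 1 - Y != 0.
Proof.
move=> N0 q0 aff.
pose pt (a : algC) := E_coords a (N.-root (map_poly iota q).[a]).
have ptE a i : mmap iota (pt a) (E_eqs N q i) = 0.
  by rewrite mmap_E_eqs rootCK // subrr.
split.
  have -> : X = mmap j (E_coords X Y) 'X_ord0 by rewrite mmapX mmap1U.
  apply: (generic_point_neq0 aff (ptE 1)).
  by rewrite mmapX mmap1U oner_neq0.
have -> : 1 - Y = mmap j (E_coords X Y) (1 - 'X_(fintype.lift ord0 ord0)).
  by rewrite rmorphB rmorph1 /= mmapX mmap1U.
apply: (generic_point_neq0 aff (ptE 0)).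
rewrite rmorphB rmorph1 /= mmapX mmap1U /pt /E_coords /=.
by rewrite horner_coef0 coef_map /= q0 rmorph0 rootC0 // subr0 oner_neq0.
Qed.

(** * The two symbols *)

Theorem theorem1p1 (N n : nat) (N_gt0 : (0 < N)%N) (n_gt0 : (0 < n)%N)
  (lambda : 'I_n -> algC)
  (lambda_neq0 : forall i, lambda i != 0) (lambda_inj : injective lambda)
  (* the curve X_{N,n} over k_X *)
  (kX : fieldExtType rat) (iX : {rmorphism kX -> algC})
  (kX_gen : generated_by iX (codom lambda))
  (lX : 'I_n -> kX) (lXE : forall i, iX (lX i) = lambda i)
  (KX : fieldType) (jX : {rmorphism kX -> KX}) (x : KX) (y : 'I_n -> KX)
  (KX_function_field : affine_function_field jX (X_eqs N lX) (X_coords x y))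
  (CX : set (set KX)) (CX_curve : smooth_projective_curve jX CX)
  (* the curve E_{N,n} over k_E *)
  (kE : fieldExtType rat) (iE : {rmorphism kE -> algC})
  (kE_gen : generated_by iE (polyseq (Phi lambda)))
  (q : {poly kE})
  (qE : map_poly iE q = 'X * \prod_i ('X - (lambda i)%:P))
  (KE : fieldType) (jE : {rmorphism kE -> KE}) (X Y : KE)
  (KE_function_field : affine_function_field jE (E_eqs N q) (E_coords X Y))
  (CE : set (set KE)) (CE_curve : smooth_projective_curve jE CE)
  (Phi_roots : forall z : algC, root (Phi lambda) z ->
     exists2 m : nat, (0 < m)%N & z ^+ m = 1) :
  [/\ symbol_in (H2M CX) (1 - x * \prod_i y i) x,
      symbol_in (H2M CE) (1 - Y) X
    & Phi lambda \is a polyOver (Num.int : {pred algC}) ->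
      (forall MX, regular_proper_model jX CX MX ->
         symbol_in (H2MZ jX CX MX) (1 - x * \prod_i y i) x) /\
      (forall ME, regular_proper_model jE CE ME ->
         symbol_in (H2MZ jE CE ME) (1 - Y) X)].
Proof.
pose qX : {poly kX} := 'X * \prod_i ('X - (lX i)%:P).
have map_qX (L : fieldType) (phi : {rmorphism kX -> L}) :
    map_poly phi qX = 'X * \prod_i ('X - (phi (lX i))%:P).
  rewrite rmorphM rmorph_prod /= map_polyX; congr (_ * _).
  by apply: eq_bigr => i _; rewrite rmorphB /= map_polyX map_polyC.
have qXE : map_poly iX qX = 'X * \prod_i ('X - (lambda i)%:P).
  by rewrite map_qX; under eq_bigr do rewrite lXE.
have [x0 fX0] := X_symbol_neq0 iX N_gt0 KX_function_field.
have X_eq : (x * \prod_i y i) ^+ N = (map_poly jX qX).[x ^+ N].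
  rewrite map_qX; apply: X_curve_eq => i; rewrite -mmap_X_eqs.
  exact: generic_point_root KX_function_field.
have [X0 fE0] := E_symbol_neq0 iE N_gt0 (root_product_coef0 qE) KE_function_field.
have E_eq : Y ^+ N = (map_poly jE q).[X ^+ 1].
  apply/eqP; rewrite expr1 -subr_eq0 -(mmap_E_eqs _ _ _ _ _ ord0).
  by rewrite (generic_point_root _ KE_function_field).
have sX : (1 < size qX)%N by rewrite (root_product_size qXE).
have sE : (1 < size q)%N by rewrite (root_product_size qE).
have uX : forall z : algC, root (map_poly iX qX - 1) z ->
  exists2 m : nat, (0 < m)%N & z ^+ m = 1 by rewrite qXE.
have uE : forall z : algC, root (map_poly iE q - 1) z ->
  exists2 m : nat, (0 < m)%N & z ^+ m = 1 by rewrite qE.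
have mX := root_product_monic qXE; have mE := root_product_monic qE.
have zX := root_product_coef0 qXE; have zE := root_product_coef0 qE.
split.
- exact: (symbol_in_H2M CX_curve N_gt0 N_gt0 mX sX zX uX X_eq x0 fX0).
- exact: (symbol_in_H2M CE_curve N_gt0 (ltn0Sn 0) mE sE zE uE E_eq X0 fE0).
move=> PhiZ; split=> M _.
- apply: (symbol_in_H2MZ CX_curve N_gt0 N_gt0 mX sX zX uX X_eq x0 fX0).
  by rewrite qXE.
apply: (symbol_in_H2MZ CE_curve N_gt0 (ltn0Sn 0) mE sE zE uE E_eq X0 fE0).
by rewrite qE.
Qed.
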